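(* $F_0^M(x,y,q)=1$, $F_1^M(x,y,q)=x$, and for $n\geq 2$, $$F_n^M(x,y,q)=xq^{n-1}F_{n-1}^M(x,y,q)+yq^{n-2}F_{n-2}^M(x,y,q).$$
   Context: $S_n(123,132,213)$ denotes the set of permutations of $[n]$ containing no subsequence order isomorphic to $123$, $132$ or $213$. For a permutation $\pi$, split it into maximal increasing runs of consecutive entries (for $\pi\in S_n(123,132,213)$ these are its layers: $\pi$ is a concatenation of increasing blocks of size $1$ or $2$, each block larger than all later blocks). Let $s(\pi)$ (resp. $d(\pi)$) be the number of such runs of length $1$ (resp. $2$). For $\pi=p_1\dots p_n$, $maj(\pi)=\sum_{i:\,p_i>p_{i+1}} i$. Define $F_n^M(x,y,q)=\sum_{\pi\in S_n(123,132,213)}x^{s(\pi)}y^{d(\pi)}q^{maj(\pi)}$. *)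

(* Defs.v *)
From mathcomp Require Import all_boot all_order all_algebra all_fingroup.

Set Implicit Arguments.
Unset Strict Implicit.
Unset Printing Implicit Defensive.

Import GRing.Theory.

(* One-line notation with values in [n] = {1, ..., n}, whereas 'S_n permutes
   {0, ..., n.-1}. *)
Definition word n (p : 'S_n) : seq nat := [seq (p i).+1 | i <- enum 'I_n].

Definition order_iso (s t : seq nat) : bool :=
  (size s == size t) &&
  [forall i : 'I_(size s), forall j : 'I_(size s),
     (nth 0 s i < nth 0 s j) == (nth 0 t i < nth 0 t j)].

(* The subsequences of w are the mask m w, for m a bit sequence of size w. *)
Definition contains (pat w : seq nat) : bool :=
  [exists m : (size w).-tuple bool, order_iso (mask m w) pat].

Definition avoiders n (pats : seq (seq nat)) : {set 'S_n} :=
  [set p : 'S_n | all (fun pat => ~~ contains pat (word p)) pats].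

(* The maximal increasing runs of consecutive entries, from left to right. *)
Fixpoint runs (w : seq nat) : seq (seq nat) :=
  if w is a :: w' then
    if runs w' is (b :: r) :: rs then
      if a < b then (a :: b :: r) :: rs else [:: a] :: (b :: r) :: rs
    else [:: [:: a]]
  else [::].

Definition nruns n (k : nat) (p : 'S_n) : nat :=
  count (fun r => size r == k) (runs (word p)).

(* The i-th entry of w, numbered from 1, is nth 0 w i.-1. *)
Definition maj n (p : 'S_n) : nat :=
  \sum_(1 <= i < n | nth 0 (word p) i < nth 0 (word p) i.-1) i.

Local Open Scope ring_scope.

(* The generating polynomial itself is the case where x, y and q are the
   indeterminates of a polynomial ring. *)
Definition FM (R : comNzRingType) (n : nat) (x y q : R) : R :=
  \sum_(p in avoiders n [:: [:: 1; 2; 3]; [:: 1; 3; 2]; [:: 2; 1; 3]]%N)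
     x ^+ nruns 1 p * y ^+ nruns 2 p * q ^+ maj p.

(* Main.v *)
(** Every entry of a permutation avoiding 123 and 132 is followed by at most
    one larger entry, and every entry of one avoiding 123 and 213 is preceded
    by at most one smaller entry.  Hence the entry 1 is last, or it is
    immediately followed by a final 2.  Deleting this last layer (of size k = 1
    or 2) and standardizing is a bijection onto the avoiders of size n - k; it
    removes one run of length k and a descent in position n - k. *)
Require Import Defs.
From mathcomp Require Import all_boot all_order all_algebra all_fingroup.
From mathcomp Require Import zify.

Local Open Scope ring_scope.

Section Words.

Local Open Scope nat_scope.

Implicit Types (u v w : seq nat) (a b c d k n : nat).

(** * Subsequences and pattern containment *)

Lemma subseq_catP (T : eqType) (s u v : seq T) :
  subseq s (u ++ v) ->
  exists s1 s2, [/\ s = s1 ++ s2, subseq s1 u & subseq s2 v].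
Proof.
case/subseqP=> m sz_m ->.
exists (mask (take (size u) m) u), (mask (drop (size u) m) v).
rewrite !mask_subseq -mask_cat ?cat_take_drop //.
by rewrite size_take_min sz_m size_cat (minn_idPl _) ?leq_addr.
Qed.

Lemma containsP pat w :
  reflect (exists2 s, subseq s w & order_iso s pat) (contains pat w).
Proof.
apply: (iffP existsP) => [[m iso_m] | [_ /subseqP[m /eqP sz_m ->] iso_m]].
  by exists (mask m w); rewrite ?mask_subseq.
by exists (Tuple sz_m).
Qed.

Lemma order_iso3 a b c d e f :
  order_iso [:: a; b; c] [:: d; e; f] =
    [&& (a < b) == (d < e), (a < c) == (d < f), (b < a) == (e < d),
        (b < c) == (e < f), (c < a) == (f < d) & (c < b) == (f < e)].
Proof.
rewrite /order_iso /=; apply/forallP/and5P => [iso | ].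
  have cmp i j (lti : i < 3) (ltj : j < 3) :=
    forallP (iso (Ordinal lti)) (Ordinal ltj).
  split; [exact: (cmp 0 1) | exact: (cmp 0 2) | exact: (cmp 1 0)
         | exact: (cmp 1 2) | ].
  by apply/andP; split; [exact: (cmp 2 0) | exact: (cmp 2 1)].
case=> ab ac ba bc /andP[ca cb] [i lti]; apply/forallP=> -[j ltj].
by move: i j lti ltj => [|[|[|i]]] [|[|[|j]]] //=; rewrite !ltnn.
Qed.

Definition patterns : seq (seq nat) :=
  [:: [:: 1; 2; 3]; [:: 1; 3; 2]; [:: 2; 1; 3]].

Definition avoids w : bool := all (fun pat => ~~ contains pat w) patterns.

(** For distinct entries, 123 and 132 are together the patterns whose first entry is smallest, and
    123 and 213 those whose last entry is largest. *)
Lemma avoidsP w : uniq w ->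
  reflect (forall a b c, subseq [:: a; b; c] w ->
             ~~ (a < minn b c) && ~~ (maxn a b < c))
          (avoids w).
Proof.
move=> uw; apply: (iffP idP) => [av a b c sw | av].
  have: uniq [:: a; b; c] by apply: subseq_uniq uw.
  rewrite /= !inE => uabc.
  case/and4P: av => n1 n2 n3 _.
  have n pat : ~~ contains pat w -> ~~ order_iso [:: a; b; c] pat.
    by apply: contra => iso; apply/containsP; exists [:: a; b; c].
  move/n: n1; move/n: n2; move/n: n3; rewrite !order_iso3; lia.
apply/allP=> pat pat_in; apply/negP=> /containsP[s sw iso].
have sz_s : size s = 3.
  by case/andP: iso => /eqP-> _; move: pat_in; rewrite !inE => /or3P[]/eqP->.
case: s sz_s sw iso => [|a [|b [|c []]]] // _ /av.
by move: pat_in; rewrite !inE => /or3P[] /eqP->; rewrite order_iso3; lia.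
Qed.

(** * Words built layer by layer *)

Definition add_layer k u : seq nat := map (addn k) u ++ iota 1 k.

(** The recursion mirrors the wanted recurrence: words are listed by the size of their last layer,
    so a sum over the list splits at [++]. *)
Fixpoint layered n : seq (seq nat) :=
  if n is m.+1 then
    map (add_layer 1) (layered m) ++
    (if m is l.+1 then map (add_layer 2) (layered l) else [::])
  else [:: [::]].

Lemma perm_add_layer k n u :
  perm_eq (add_layer k u) (iota 1 (k + n)) = perm_eq u (iota 1 n).
Proof.
rewrite iotaD perm_sym perm_catC perm_sym perm_cat2r addnC iotaDl.
by apply/idP/idP => [/(perm_map_inj (@addnI k)) | /perm_map].
Qed.

Lemma add_layer_inj k : injective (add_layer k).
Proof.
move=> u v eq_uv; have := congr1 size eq_uv.
rewrite !size_cat => /addIn sz_uv; move/eqP: eq_uv.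
by rewrite eqseq_cat // eqxx andbT => /eqP/(inj_map (@addnI k)).
Qed.

Lemma uniq_perm_iota n w : perm_eq w (iota 1 n) -> uniq w.
Proof. by move/perm_uniq->; apply: iota_uniq. Qed.

(** A triple that meets both the shifted part and the layer has its first entry above [k] and its
    last entry at most [k], so it neither starts with its minimum nor ends with its maximum. Since
    the layer has at most two entries, every other triple lies in the shifted copy of [u]. *)
Lemma avoids_add_layer k n u : k <= 2 -> perm_eq u (iota 1 n) ->
  avoids (add_layer k u) = avoids u.
Proof.
move=> k_le2 pu; have uu := uniq_perm_iota _ _ pu.
have ul : uniq (add_layer k u).
  by apply: (uniq_perm_iota (k + n)); rewrite perm_add_layer.
apply/(avoidsP _ ul)/(avoidsP _ uu) => av a b c.
  move=> /(map_subseq (addn k)) /= sub.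
  have /av : subseq [:: k + a; k + b; k + c] (add_layer k u).
    exact: subseq_trans sub (prefix_subseq _ _).
  lia.
have big x : x \in map (addn k) u -> k < x.
  case/mapP=> y; rewrite (perm_mem pu) mem_iota => ? ->; lia.
case/subseq_catP=> s1 [s2 [def_s sub1 sub2]].
case: s1 def_s sub1 => [|a1 [|b1 [|c1 s1]]] /=.
- by move=> def_s; move/size_subseq: sub2; rewrite -def_s size_iota /=; lia.
- case=> <- def_s2; rewrite sub1seq => /big lt_ka.
  have: c \in iota 1 k by apply: (mem_subseq sub2); rewrite -def_s2 !inE eqxx orbT.
  rewrite mem_iota; lia.
- case=> <- <- def_s2 /mem_subseq sub1.
  have lt_ka : k < a by apply/big/sub1; rewrite !inE eqxx.
  have lt_kb : k < b by apply/big/sub1; rewrite !inE eqxx orbT.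
  by move: sub2; rewrite -def_s2 sub1seq mem_iota; lia.
- case=> -> -> -> /esym/eqP.
  have -> : (s1 ++ s2 == [::]) = (s1 == [::]) && (s2 == [::]).
    by case: (s1).
  case/andP=> /eqP-> _ /subseqP[m _]; rewrite -map_mask.
  case def_t: (mask m u) => [|a' [|b' [|c' []]]] //= [-> -> ->].
  have /av : subseq [:: a'; b'; c'] u by rewrite -def_t mask_subseq.
  lia.
Qed.

(** The lower bound on the entries makes the truncated subtraction invertible. *)
Lemma add_layer_sub k l : {in l, forall a, k <= a} ->
  add_layer k (map (subn^~ k) l) = l ++ iota 1 k.
Proof.
move=> le_k; rewrite /add_layer -map_comp; congr (_ ++ _).
by rewrite -[RHS]map_id; apply/eq_in_map => a /le_k /=; lia.
Qed.

Lemma avoids_last_layer n w : perm_eq w (iota 1 n.+1) -> avoids w ->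
  exists u, w = add_layer 1 u \/ 0 < n /\ w = add_layer 2 u.
Proof.
move=> pw av_w; have uw := uniq_perm_iota _ _ pw.
have {av_w} av := avoidsP _ uw av_w.
have mem_w a : (a \in w) = (0 < a < n.+2).
  by rewrite (perm_mem pw) mem_iota; lia.
have sz_w : size w = n.+1 by rewrite (perm_size pw) size_iota.
have w1 : 1 \in w by rewrite mem_w.
case/path.splitPr: w / w1 pw uw av mem_w sz_w => l r pw uw av mem_w sz_w.
(* Split by the number of entries after 1: none gives a layer of size 1, one gives a layer of size
   2, and more are impossible. *)
case: r => [|c [|b r]] in pw uw av mem_w sz_w *.
- exists (map (subn^~ 1) l); left; rewrite add_layer_sub // => a al.
  by have := mem_w a; rewrite mem_cat al; lia.
- have n_gt0 : 0 < n by move: sz_w; rewrite size_cat /=; lia.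
  have /andP[c_gt0 _] : 0 < c < n.+2 by rewrite -mem_w mem_cat !inE eqxx !orbT.
  move: (uw); rewrite cat_uniq /= inE orbF negb_or.
  case/and3P=> _ /andP[_ lc] /andP[c1 _].
  (* The triple [a], 1, [c] must not end with its largest entry. *)
  have gt_c a : a \in l -> c < a.
    move=> al; have ac : a != c by apply: contraNneq lc => <-.
    have := mem_w a; rewrite mem_cat al /=.
    have /av : subseq [:: a; 1; c] (l ++ [:: 1; c]).
      by rewrite (@cat_subseq _ [:: a] [:: 1; c]) ?sub1seq.
    lia.
  (* The value 2 occurs somewhere, but all entries before 1 exceed [c], which is itself at least
     2. *)
  have def_c : c = 2.
    have: 2 \in l ++ [:: 1; c] by rewrite mem_w; lia.
    by rewrite mem_cat !inE => /orP[/gt_c|]; lia.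
  exists (map (subn^~ 2) l); right; rewrite add_layer_sub ?def_c //.
  by move=> a /gt_c; lia.
(* With two entries after it, 1 would be the first and smallest entry of a triple. *)
- have /av : subseq [:: 1; c; b] (l ++ [:: 1, c, b & r]).
    by apply: subseq_trans (suffix_subseq _ _); rewrite /= !eqxx sub0seq.
  have: 0 < c < n.+2 by rewrite -mem_w mem_cat !inE eqxx !orbT.
  have: 0 < b < n.+2 by rewrite -mem_w mem_cat !inE eqxx !orbT.
  move: uw; rewrite cat_uniq /= !inE; lia.
Qed.

(** Adding a layer preserves both conditions, and [avoids_last_layer] supplies the layer to remove;
    strong induction covers both layer sizes. *)
Lemma mem_layered n w :
  (w \in layered n) = perm_eq w (iota 1 n) && avoids w.
Proof.
elim/ltn_ind: n w => -[|n] IH w.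
  rewrite inE; apply/eqP/andP => [->|[/perm_size/size0nil-> //]].
  by split=> //; apply/avoidsP.
have mem_layer k m u : k <= 2 -> n.+1 = k + m -> u \in layered m -> 0 < k ->
    perm_eq (add_layer k u) (iota 1 n.+1) && avoids (add_layer k u).
  move=> k2 def_n um k0; move: um; rewrite IH; last lia.
  by case/andP=> pu av; rewrite def_n perm_add_layer (avoids_add_layer k m) ?pu.
rewrite mem_cat; apply/orP/andP => [|[pw av]].
  case=> [/mapP[u un ->] | ]; first exact/andP/(mem_layer 1 n).
  by case: n {IH} mem_layer => // n mem_layer /mapP[u un ->];
    exact/andP/(mem_layer 2 n).
have [u def_w] := avoids_last_layer _ _ pw av.
case: def_w av pw => [-> | [n_gt0 ->]] av pw.
  left; apply: map_f; rewrite IH //.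
  have pu : perm_eq u (iota 1 n) by rewrite -(perm_add_layer 1).
  by rewrite pu -(avoids_add_layer 1 n).
right; case: n n_gt0 IH {mem_layer} pw => // n _ IH pw.
apply: map_f; rewrite IH //.
have pu : perm_eq u (iota 1 n) by rewrite -(perm_add_layer 2).
by rewrite pu -(avoids_add_layer 2 n).
Qed.

Lemma layered_uniq n : uniq (layered n).
Proof.
elim/ltn_ind: n => -[|n] IH //=.
rewrite cat_uniq (map_inj_uniq (@add_layer_inj 1)) IH //=.
case: n IH => // n IH; rewrite (map_inj_uniq (@add_layer_inj 2)) IH // andbT.
(* The two lists are disjoint: words of the first end in 1, words of the second in 2. *)
apply/hasPn => _ /mapP[u _ ->]; apply/negP => /mapP[v _].
by move/(congr1 (last 0)); rewrite !last_cat.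
Qed.

(** * One-line words of permutations *)

Lemma size_word n (p : 'S_n) : size (word p) = n.
Proof. by rewrite size_map size_enum_ord. Qed.

Lemma perm_word n (p : 'S_n) : perm_eq (word p) (iota 1 n).
Proof.
rewrite uniq_perm ?iota_uniq //.
  rewrite map_inj_uniq ?enum_uniq // => i j [/val_inj].
  exact: perm_inj.
move=> a; rewrite mem_iota; apply/mapP/idP => [[i _ ->] | ].
  by have := ltn_ord (p i); lia.
case: a => // a lt_a; have {}lt_a : a < n by lia.
by exists ((p^-1)%g (Ordinal lt_a)); rewrite ?mem_enum ?permKV.
Qed.

Lemma word_inj n : injective (@word n).
Proof.
move=> p1 p2 /eq_in_map eq_w; apply/permP => i.
by apply: val_inj; apply: succn_inj; apply: eq_w; rewrite mem_enum.
Qed.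

Lemma word_surj n w : perm_eq w (iota 1 n) -> exists p : 'S_n, word p = w.
Proof.
move=> pw; have sz_w : size w == n by rewrite (perm_size pw) size_iota.
have : perm_eq (Tuple sz_w) (iota_tuple n 1) by [].
case/tuple_permP=> p /= ->; exists p; apply: eq_map => i.
by rewrite (tnth_nth 0) nth_iota.
Qed.

(** This turns the sum over a set of permutations into a sum over an explicit list. *)
Lemma perm_word_avoiders n :
  perm_eq [seq word p | p <- enum (avoiders n patterns)] (layered n).
Proof.
apply: uniq_perm; last 1 first.
- move=> w; rewrite mem_layered; apply/mapP/andP => [[p] | [/word_surj[p <-] av]].
    by rewrite mem_enum inE => av ->; rewrite perm_word.
  by exists p; rewrite // mem_enum inE.
- by rewrite (map_inj_uniq (@word_inj n)) enum_uniq.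
- exact: layered_uniq.
Qed.

(** * Runs and major index of words *)

Definition word_nruns k w : nat := count (fun r => size r == k) (runs w).

Definition word_maj w : nat :=
  \sum_(1 <= i < size w | nth 0 w i < nth 0 w i.-1) i.

Lemma runs_map f w : {mono f : a b / a < b} ->
  runs (map f w) = map (map f) (runs w).
Proof.
move=> mono_f; elim: w => //= a w ->.
by case: (runs w) => [|[|b r] rs] //=; rewrite mono_f; case: ifP.
Qed.

(** Knowing the first letter of the first run lets the match in [runs] reduce. *)
Lemma runs_head a w : exists r rs, runs (a :: w) = (a :: r) :: rs.
Proof.
elim: w a => [|b w IH] a; first by exists [::], [::].
have [r [rs def_r]] := IH b.
change (runs [:: a, b & w]) with
  (if runs (b :: w) is (c :: s) :: t then
     if a < c then (a :: c :: s) :: t else [:: a] :: (c :: s) :: t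
   else [:: [:: a]]).
rewrite def_r.
by case: ifP => _; [exists (b :: r), rs | exists [::], ((b :: r) :: rs)].
Qed.

(** There is a descent from the last entry of a nonempty [u] to [a], so no run crosses the
    boundary. *)
Lemma runs_cat u a v : {in u, forall b, a < b} ->
  runs (u ++ a :: v) = runs u ++ runs (a :: v).
Proof.
elim: u => //= b u IH lt_a.
rewrite IH => [|c cu]; last by apply: lt_a; rewrite inE cu orbT.
have lt_ab : a < b by apply: lt_a; rewrite inE eqxx.
case: u {IH lt_a} => [|c u].
  have [r [rs /= ->]] := runs_head a v.
  by rewrite /= ltnNge ltnW.
have [r [rs ->]] := runs_head c u.
by rewrite /=; case: ifP.
Qed.

Lemma nruns_add_layer j k u : 0 < k <= 2 -> {in u, forall a, 0 < a} ->
  word_nruns j (add_layer k u) = word_nruns j u + (k == j).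
Proof.
move=> k_range u_gt0; rewrite /word_nruns /add_layer.
have -> : iota 1 k = 1 :: iota 2 k.-1 by case: k k_range.
rewrite runs_cat; last by move=> _ /mapP[a /u_gt0 a_gt0 ->]; lia.
rewrite runs_map; last by move=> a b; rewrite ltn_add2l.
rewrite count_cat count_map; congr (_ + _).
  by apply: eq_count => r /=; rewrite size_map.
(* The layer is increasing, hence a single run of length [k]. *)
by case: k k_range => [|[|[|k]]] //= _; rewrite addn0.
Qed.

(** The only new candidate for a descent is position [size u]. For empty [u] the default 0 of [last]
    rules it out. *)
Lemma maj_rcons u a :
  word_maj (rcons u a) = word_maj u + (if a < last 0 u then size u else 0).
Proof.
case/lastP: u => [|u b]; first by rewrite /word_maj !big_geq.
rewrite /word_maj !size_rcons last_rcons big_mkcond big_nat_recr //=.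
rewrite -big_mkcond; congr (_ + _); last first.
  by rewrite !nth_rcons !size_rcons ltnn eqxx leqnn ltnn eqxx.
rewrite big_nat_cond [RHS]big_nat_cond; apply: eq_bigl => i.
case i_range: (1 <= i < (size u).+1) => //=.
by rewrite !(nth_rcons _ (rcons _ _)) !size_rcons; do 2![rewrite ifT; last lia].
Qed.

Lemma maj_map_add k u : word_maj (map (addn k) u) = word_maj u.
Proof.
rewrite /word_maj size_map big_nat_cond [RHS]big_nat_cond; apply: eq_bigl => i.
(* The range keeps both indices inside [u]; beyond it [nth] returns the default 0, which is not
   shifted. *)
case i_range: (1 <= i < size u) => //=.
by rewrite !(nth_map 0) ?ltn_add2l //; lia.
Qed.

(** A nonempty shifted part ends above 1, which creates a descent at position [size u]; for empty
    [u] that term is 0. A final 2 after 1 adds no descent. *)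
Lemma maj_add_layer k u : 0 < k <= 2 -> {in u, forall a, 0 < a} ->
  word_maj (add_layer k u) = word_maj u + size u.
Proof.
move=> k_range u_gt0; set u' := map (addn k) u.
have maj1 : word_maj (rcons u' 1) = word_maj u + size u.
  rewrite maj_rcons maj_map_add size_map; congr (_ + _).
  rewrite /u'; case/lastP: (u) u_gt0 => //= v a v_gt0.
  rewrite map_rcons last_rcons ifT //.
  by have := v_gt0 a; rewrite mem_rcons inE eqxx => /(_ isT); lia.
case: k k_range @u' maj1 => [|[|[|k]]] //= _ maj1.
  by rewrite /add_layer cats1.
have -> : add_layer 2 u = rcons (rcons (map (addn 2) u) 1) 2.
  by rewrite /add_layer -!cats1 -catA.
by rewrite maj_rcons last_rcons addn0 maj1.
Qed.

End Words.

(** * The generating polynomial *)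

Definition word_weight (R : comNzRingType) (x y q : R) (w : seq nat) : R :=
  x ^+ word_nruns 1 w * y ^+ word_nruns 2 w * q ^+ word_maj w.

Lemma FM_layered (R : comNzRingType) (n : nat) (x y q : R) :
  FM n x y q = \sum_(w <- layered n) word_weight R x y q w.
Proof.
rewrite -(perm_big _ (perm_word_avoiders n)) /= big_map big_enum /=.
by apply: eq_bigr => p _; rewrite /word_weight /word_maj size_word.
Qed.

(** Each weight gains the same factor: [x] or [y], selected by the boolean exponents, and [q ^+ n]
    for the descent just before the layer. *)
Lemma sum_add_layer (R : comNzRingType) (k n : nat) (x y q : R) :
  (0 < k <= 2)%N ->
  \sum_(w <- map (add_layer k) (layered n)) word_weight R x y q w =
    x ^+ (k == 1)%N * y ^+ (k == 2)%N * q ^+ n * FM n x y q.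
Proof.
move=> k_range; rewrite FM_layered big_map GRing.mulr_sumr.
rewrite big_seq [RHS]big_seq; apply: eq_bigr => u.
rewrite mem_layered => /andP[pu _].
have u_gt0 : {in u, forall a, (0 < a)%N}.
  by move=> a; rewrite (perm_mem pu) mem_iota => /andP[].
rewrite /word_weight !nruns_add_layer // maj_add_layer //.
rewrite (perm_size pu) size_iota !GRing.exprD.
by rewrite (GRing.mulrACA (x ^+ _)) (GRing.mulrACA (_ * _)) GRing.mulrC.
Qed.

Theorem theorem2p2 (R : comNzRingType) (x y q : R) :
  [/\ FM 0 x y q = 1,
      FM 1 x y q = x
    & forall n : nat, (2 <= n)%N ->
        FM n x y q = x * q ^+ (n - 1) * FM (n - 1) x y q
                   + y * q ^+ (n - 2) * FM (n - 2) x y q].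
Proof.
(* A word of size at most 1 has an empty range of descent positions, which settles both initial
   values. *)
have maj_small w : (size w <= 1)%N -> word_maj w = 0%N.
  by move=> sz_w; rewrite /word_maj big_geq.
split=> [||[|[|n]] // _].
- by rewrite FM_layered big_seq1 /word_weight maj_small // !GRing.mulr1.
- by rewrite FM_layered big_seq1 /word_weight maj_small // !GRing.mulr1.
(* [layered n.+2] unfolds to the words ending in a layer of size 1, over [layered n.+1], followed by
   those ending in a layer of size 2, over [layered n]. *)
rewrite FM_layered big_cat (sum_add_layer _ 1 n.+1) // (sum_add_layer _ 2 n) //.
by rewrite !subSS !subn0 !GRing.mul1r !GRing.mulr1.
Qed.
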